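(* Let $G$ be a group belonging to the class $\mathcal{S}$, and suppose $G$ acts on the real line $\mathbb{R}$ by order-preserving homeomorphisms. Assume that there is an element $T\in G$ that acts on $\mathbb{R}$ without fixed points. Then there is a nonzero Radon measure $\mu$ on $\mathbb{R}$ which is quasi-preserved by $G$.
   Context: A group has subexponential growth if it is finitely generated and its word growth function (with respect to some, equivalently any, finite generating set) grows subexponentially. A group has locally subexponential growth if every finitely generated subgroup of it has subexponential growth (the group itself need not be finitely generated). The class $\mathcal{S}$ consists of the groups $G$ admitting a finite filtration $\{id\}=G^{d+1}\lhd G^{d}\lhd \cdots \lhd G^{1}\lhd G^{0}=G$ by subgroups that are normal in $G$, such that each successive quotient $G^{i-1}/G^{i}$ ($i=1,\dots,d+1$) has locally subexponential growth. (In particular all solvable groups and all groups of subexponential growth lie in $\mathcal{S}$.) A Borel measure $\mu$ on $\mathbb{R}$ is a Radon measure if it gives finite mass to compact sets. For $g$ acting on $\mathbb{R}$, $g_*\mu$ is the measure $B\mapsto \mu(g^{-1}(B))$. A measure $\mu$ is quasi-preserved (quasi-invariant) by $G$ if for every $g\in G$ there is $\lambda_g\in\mathbb{R}$ with $g_*\mu=\lambda_g\mu$. *)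

(* Defs.v *)
From HB Require Import structures.
From mathcomp Require Import all_boot all_order all_algebra.
From mathcomp Require Import all_classical all_reals all_analysis.
Set Implicit Arguments. Unset Strict Implicit. Unset Printing Implicit Defensive.
Import Order.TTheory GRing.Theory Num.Theory.
Import numFieldNormedType.Exports.
Local Open Scope classical_set_scope.
Local Open Scope ring_scope.

Definition is_subgroup (G : groupType) (H : set G) : Prop :=
  [/\ H 1%g, (forall x y, H x -> H y -> H (x * y)%g) & (forall x, H x -> H (x^-1)%g)].

Definition normal_in_G (G : groupType) (H : set G) : Prop :=
  is_subgroup H /\ forall g x, H x -> H (g^-1 * x * g)%g.

Definition word_ball (G : groupType) (S : seq G) (n : nat) : set G :=
  [set g | exists w : seq G,
     [/\ (size w <= n)%N, all (fun s => (s \in S) || (s^-1 \in S)%g) w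
       & g = foldr (fun a b => a * b)%g 1%g w]].

(* The image of A in the quotient by the normal subgroup K has at most m
   elements: m (left) cosets of K cover A. *)
Definition cosets_le (G : groupType) (K : set G) (A : set G) (m : nat) : Prop :=
  exists l : seq G, (size l <= m)%N /\
    forall x, A x -> exists2 y, y \in l & K (y^-1 * x)%g.

(* subexponential growth, in the quotient by K, of the subgroup generated by
   the images of S:  b(n) = #(image of the n-ball mod K),  and
   lim b(n)^(1/n) = 1, i.e. for every c > 1, eventually b(n) <= c^n. *)
Definition subexp_growth_mod (R : realType) (G : groupType) (K : set G)
    (S : seq G) : Prop :=
  forall c : R, 1 < c -> exists N : nat, forall n : nat, (N <= n)%N ->
    exists m : nat, m%:R <= c ^+ n /\ cosets_le K (word_ball S n) m.

(* the quotient H/K has locally subexponential growth: every finitely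
   generated subgroup of H/K (generated by the images of a finite S ⊆ H)
   has subexponential growth *)
Definition loc_subexp_quot (R : realType) (G : groupType) (H K : set G) : Prop :=
  forall S : seq G, (forall s, s \in S -> H s) -> subexp_growth_mod R K S.

Definition in_class_S (R : realType) (G : groupType) : Prop :=
  exists (d : nat) (N : nat -> set G),
    [/\ N 0%N = setT, N d.+1 = [set 1%g],
        (forall i, (i <= d.+1)%N -> normal_in_G (N i)),
        (forall i, (i <= d)%N -> N i.+1 `<=` N i)
      & (forall i, (i <= d)%N -> loc_subexp_quot R (N i) (N i.+1))].

Definition oph_action (R : realType) (G : groupType) (rho : G -> R -> R) : Prop :=
  [/\ rho 1%g = id,
      (forall g h, rho (g * h)%g = rho g \o rho h)
    & (forall g, [/\ bijective (rho g), continuous (rho g)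
                   & {homo rho g : x y / x < y}])].

Definition radon (R : realType) (mu : {measure set (measurableTypeR R) -> \bar R}) :=
  forall K : set R, compact K -> (mu K < +oo)%E.

Definition quasi_invariant (R : realType) (G : groupType) (rho : G -> R -> R)
    (mu : {measure set (measurableTypeR R) -> \bar R}) : Prop :=
  forall g : G, exists lam : R, forall B : set (measurableTypeR R),
    measurable B -> mu (rho g @^-1` B) = (lam%:E * mu B)%E.

(* Main.v *)
(* Replacing T by its inverse, x < T x for all x. Let N be the last term of the
   filtration without a global fixed point and let F be the closed G-invariant
   set of fixed points of the next term: N acts on F with locally subexponential
   growth, hence without ping-pong pairs. If f in N has a fixed point in F, then
   f x <= T x on F, since otherwise f and its conjugate by T would be crossed.
   Hence the elements of N with a fixed point in F form a subgroup with bounded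
   orbits, whose fixed points form a nonempty closed G-invariant set X in F. The
   rest of N acts freely on X, and Hoelder's theorem gives a monotone phi and a
   homomorphism tau : N -> R such that phi (h x) = phi x + tau h.
   If tau N is dense, phi is determined up to affine maps, so phi o k is an
   affine function of phi for every k in G. Otherwise N acts on X as an infinite
   cyclic central undistorted group, so the preceding term of the filtration acts
   on X with locally subexponential growth, and one repeats the argument with it.
   The Stieltjes measure of phi is quasi-preserved. *)

Require Import Defs.
From HB Require Import structures.
From mathcomp Require Import all_boot all_order all_algebra.
From mathcomp Require Import all_classical all_reals all_analysis.
From mathcomp Require Import ring lra zify.
Import Order.TTheory GRing.Theory Num.Theory.
Import numFieldNormedType.Exports.
Local Open Scope classical_set_scope.
Local Open Scope ring_scope.

Set Implicit Arguments.
Unset Strict Implicit.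
Unset Printing Implicit Defensive.

(** * Actions on the line and crossings *)

(** The kernel of the action on [F] when [F] is stable; growth modulo it is the growth of the
    transformations induced on [F]. *)
Definition pstab {R : realType} {G : groupType} (rho : G -> R -> R) (F : set R) :
    set G :=
  [set g | forall x, F x -> rho g x = x].

Definition action_stable {R : realType} {G : groupType} (rho : G -> R -> R)
    (F : set R) : Prop :=
  forall g x, F x -> F (rho g x).

Section Action.
Context (R : realType) (G : groupType) (rho : G -> R -> R).
Hypothesis hrho : oph_action rho.

Lemma act1 x : rho 1%g x = x.
Proof. by case: hrho => ->. Qed.

Lemma actM g h x : rho (g * h)%g x = rho g (rho h x).
Proof. by case: hrho => _ ->. Qed.

Lemma actK g x : rho g^-1%g (rho g x) = x.
Proof. by rewrite -actM mulVg act1. Qed.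

Lemma actKV g x : rho g (rho g^-1%g x) = x.
Proof. by rewrite -actM mulgV act1. Qed.

Lemma le_act g : {mono rho g : x y / x <= y}.
Proof. by case: hrho => _ _ /(_ g)[_ _ /le_mono]. Qed.

Lemma lt_act g : {mono rho g : x y / x < y}.
Proof. exact: (leW_mono (le_act g)). Qed.

Lemma act_inj g : injective (rho g).
Proof. by move=> x y e; rewrite -(actK g x) e actK. Qed.

Lemma act_fixV g x : rho g x = x -> rho g^-1%g x = x.
Proof. by move=> e; rewrite -{1}e actK. Qed.

Lemma act_fixX g x n : rho g x = x -> rho (g ^+ n)%g x = x.
Proof. by move=> e; elim: n => [|n IH]; rewrite ?act1// expgS actM IH. Qed.

Lemma closed_fixed g : closed [set x | rho g x = x].
Proof.
have [_ cont _] := let: And3 _ _ h := hrho in h g.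
have -> : [set x | rho g x = x] = (fun x => rho g x - x) @^-1` [set x | x = 0].
  by apply/seteqP; split=> x /= => [->|/eqP]; rewrite ?subrr// subr_eq0 => /eqP.
have c : continuous (fun x => rho g x - x : R).
  by move=> x; apply: (@cvgB _ R^o) => //; exact: cont.
by move/continuous_closedP : c; apply; exact: closed_eq.
Qed.

Lemma closed_sup_mem (F A : set R) :
  closed F -> A `<=` F -> A !=set0 -> has_ubound A -> F (sup A).
Proof.
by move=> cF AF A0 uA; apply: cF; apply: (closureS AF); exact: closure_sup.
Qed.

(** The limit is the supremum of the increasing orbit. It is fixed because [f] shifts the orbit by
    one step, and it lies in [F] because [F] is closed and stable. *)
Lemma orbit_lim F f x M : closed F -> action_stable rho F -> F x ->
  x <= rho f x -> (forall n, rho (f ^+ n)%g x <= M) ->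
  exists b, [/\ F b, rho f b = b, forall n, rho (f ^+ n)%g x <= b
    & forall y, y < b -> exists n, y < rho (f ^+ n)%g x].
Proof.
move=> cF sF Fx xf hM; pose A := [set rho (f ^+ n)%g x | n in [set: nat]].
have A0 : A !=set0 by exists x, 0%N => //; rewrite act1.
have uA : has_ubound A by exists M => _ [n _ <-]; exact: hM.
have hub n : rho (f ^+ n)%g x <= sup A by apply: ub_le_sup => //; exists n.
have hcof y : y < sup A -> exists n, y < rho (f ^+ n)%g x.
  by move=> ysup; have [_ [n _ <-] yn] := sup_gt A0 ysup; exists n.
exists (sup A); split=> //.
  by apply: closed_sup_mem => // _ [n _ <-]; exact: sF.
apply/eqP; rewrite eq_le !leNgt; apply/andP; split; apply/negP.
- rewrite -[ltLHS](actKV f) lt_act => /hcof[n].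
  by rewrite -(lt_act f) actKV -actM -expgS ltNge hub.
- move=> /hcof[n]; apply/negP; rewrite -leNgt.
  have : rho (f ^+ n.+1)%g x <= rho f (sup A) by rewrite expgS actM le_act.
  by apply: le_trans; rewrite expgSr actM le_act.
Qed.

Lemma subgroup_expg N (f : G) n : is_subgroup N -> N f -> N (f ^+ n)%g.
Proof.
by case=> N1 NM _ Nf; elim: n => // n IH; rewrite expgS; exact: NM.
Qed.

End Action.

(** * Ping-pong pairs and crossed elements *)

Section Crossing.
Context (R : realType) (G : groupType) (rho : G -> R -> R).
Hypothesis hrho : oph_action rho.
Context (N : set G) (F : set R).
Hypothesis growth : loc_subexp_quot R N (pstab rho F).

(* Ping-pong: positive words in [h1, h2] of a given length map [p, b] onto
   pairwise disjoint intervals, so they are separated by their value at [b]. *)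
Lemma no_pingpong p b h1 h2 : N h1 -> N h2 -> F b -> p <= b ->
  p <= rho h1 p -> rho h1 b < rho h2 p -> rho h2 b <= b -> False.
Proof.
move=> Nh1 Nh2 Fb pb ph1 h12 h2b.
pose h (c : bool) := if c then h1 else h2.
pose ev (w : seq bool) := foldr (fun a b => a * b)%g 1%g (map h w).
have evJ w : p <= rho (ev w) b <= b.
  elim: w => [|c w /andP[IH1 IH2]]; first by rewrite (act1 hrho) pb lexx.
  rewrite /ev /= -/(ev w) (actM hrho).
  have ph2 : p <= rho h2 p.
    by rewrite (le_trans ph1)// (le_trans _ (ltW h12))// (le_act hrho).
  have h1b : rho h1 b <= b.
    by rewrite (le_trans (ltW h12))// (le_trans _ h2b)// (le_act hrho).
  case: c => /=; apply/andP; split.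
  - by rewrite (le_trans ph1)// (le_act hrho).
  - by rewrite (le_trans _ h1b)// (le_act hrho).
  - by rewrite (le_trans ph2)// (le_act hrho).
  - by rewrite (le_trans _ h2b)// (le_act hrho).
have sep w w' : rho h1 (rho (ev w) b) <> rho h2 (rho (ev w') b).
  apply/eqP; rewrite lt_eqF//.
  have /andP[_ le1] := evJ w; have /andP[le2 _] := evJ w'.
  by rewrite (@le_lt_trans _ _ (rho h1 b)) ?(le_act hrho)// (lt_le_trans h12)// (le_act hrho).
have evI w w' : size w = size w' -> rho (ev w) b = rho (ev w') b -> w = w'.
  elim: w w' => [|c w IH] [|c' w'] //= [sw].
  rewrite /ev /= -/(ev w) -/(ev w') !(actM hrho).
  case: c; case: c' => /= e.
  - by rewrite (IH w')//; apply: (act_inj _ e).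
  - by have := sep _ _ e.
  - by have := sep _ _ (esym e).
  - by rewrite (IH w')//; apply: (act_inj _ e).
have hS s : s \in [:: h1; h2] -> N s by rewrite !inE => /orP[]/eqP->.
(* Any constant strictly between 1 and 2 serves against the [2 ^ n] words of length [n]. The length
   [n0.+1] is positive, so that [(3 / 2) ^ n < 2 ^ n] is strict. *)
have c1 : 1 < 3 / 2 :> R by lra.
have [n0 /(_ n0.+1 (leqnSn _))[m [mc [l [lm hl]]]]] := growth hS c1.
pose n := n0.+1.
pose L := [seq rho (ev (val w)) b | w <- enum {: n.-tuple bool}].
have uL : uniq L.
  rewrite map_inj_uniq ?enum_uniq// => w w' /evI e; apply: val_inj; apply: e.
  by rewrite !size_tuple.
(* Since [b] lies in [F], a word and the representative of its coset agree at [b]; so there are at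
   most as many values as cosets. *)
have sL : {subset L <= [seq rho y b | y <- l]}.
  move=> _ /mapP[w _ ->].
  have /hl[y yl] : word_ball [:: h1; h2] n (ev (val w)).
    exists (map h w); rewrite size_map size_tuple; split=> //.
    by apply/allP => _ /mapP[c _ ->]; rewrite /h !inE; case: c; rewrite eqxx ?orbT.
  move=> /(_ b Fb); rewrite (actM hrho) => e.
  by apply/mapP; exists y => //; rewrite -{2}e (actKV hrho).
have := uniq_leq_size uL sL.
rewrite size_map -cardE card_tuple card_bool size_map => /leq_trans/(_ lm).
rewrite -(ler_nat R) => /le_trans/(_ mc); rewrite natrX leNgt => /negP; apply.
by rewrite ltrXn2r//; lra.
Qed.

Hypothesis grpN : is_subgroup N.

(** High powers of [f] push points towards [b]. After [g], one power brings [[p, b]] back into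
    itself but short of [b]; a higher power alone then sends [[p, b]] to the right of that image.
    This is a ping-pong pair. *)
Lemma no_crossing f g x b : N f -> N g -> x < rho f x -> F b ->
  rho f b = b -> (forall n, rho (f ^+ n)%g x <= b) ->
  (forall y, y < b -> exists n, y < rho (f ^+ n)%g x) ->
  rho f^-1%g x < rho g b -> rho g b < b -> False.
Proof.
move=> Nf Ng xf Fb fb hub hcof gb1 gb2.
have xb : x < b by rewrite (lt_le_trans xf)// (hub 1%N).
(* The first bound puts [p] in reach of the powers of [f]; the second gives [f^-1 x <= g p], and the
   additional factor in [f ^+ n.+1] absorbs this [f^-1]. *)
pose p := Num.max x (rho g^-1%g (rho f^-1%g x)).
have pb : p < b.
  by rewrite gt_max xb/= -(lt_act hrho g) (actKV hrho).
have [n pn] := hcof _ pb.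
have gp : rho f^-1%g x <= rho g p.
  by rewrite -[leLHS](actKV hrho g) (le_act hrho) le_max lexx orbT.
have fX k : rho (f ^+ k)%g b = b by exact: act_fixX.
have [m hm] : exists m, rho (f ^+ n.+1 * g)%g b < rho (f ^+ m)%g x.
  by apply: hcof; rewrite (actM hrho) -[ltRHS](fX n.+1) (lt_act hrho).
have NX k : N (f ^+ k)%g by exact: subgroup_expg.
apply: (@no_pingpong p b (f ^+ n.+1 * g)%g (f ^+ m)%g) => //.
- by case: grpN => _ NM _; exact: NM.
- exact: ltW.
- rewrite (ltW (lt_le_trans pn _))// (actM hrho).
  rewrite -[in leLHS](actKV hrho f x) -(actM hrho) -expgSr.
  by rewrite (le_act hrho).
- by rewrite (lt_le_trans hm)// (le_act hrho) le_max lexx.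
- by rewrite fX.
Qed.

End Crossing.

(** * Elements with fixed points *)

(** If [T x < f x], let [b] be the limit of the orbit of [x] under [f]. Then [T f^-1 T^-1] moves [b]
    to the left, but not as far as [f^-1 x], which is a crossing. *)
Lemma fix_translate_half (R : realType) (G : groupType) (rho : G -> R -> R)
    (N : set G) (F : set R) (T : G) :
  oph_action rho -> loc_subexp_quot R N (pstab rho F) ->
  normal_in_G N -> closed F -> action_stable rho F ->
  (forall x, x < rho T x) ->
  forall f z x, N f -> F z -> rho f z = z -> F x -> x < z ->
    rho f x <= rho T x.
Proof.
move=> hrho growth [grpN nN] cF sF Tgt f z x Nf Fz fz Fx xz.
rewrite leNgt; apply/negP => Tf.
have xf : x < rho f x by exact: lt_trans (Tgt x) Tf.
have hz n : rho (f ^+ n)%g x <= z.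
  by rewrite -[leRHS](act_fixX hrho n fz) (le_act hrho) ltW.
have [b [Fb fb hub hcof]] := orbit_lim hrho cF sF Fx (ltW xf) hz.
pose w := rho T^-1%g b.
have wT : rho T w = b by rewrite (actKV hrho).
have xw : x < w by rewrite -(lt_act hrho T) wT (lt_le_trans Tf)// (hub 1%N).
have wb : w < b by rewrite -wT.
(* The point [w] lies between two consecutive points of the orbit of [x], so [f] moves it to the
   right too. *)
have wf : w < rho f w.
  have [n wn nmin] := ex_minnP (hcof _ wb).
  case: n wn nmin => [|n] wn nmin; first by move: wn; rewrite (act1 hrho) ltNge ltW.
  rewrite (lt_le_trans wn)// expgS (actM hrho) (le_act hrho) leNgt.
  by apply/negP => /nmin; rewrite ltnn.
pose g := (T^-1^-1 * f^-1 * T^-1)%g.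
have Ng : N g by apply: nN; case: grpN => _ _ NV; exact: NV.
have gE : rho g b = rho T (rho f^-1%g w) by rewrite /g invgK !(actM hrho).
apply: (no_crossing hrho growth grpN Nf Ng xf Fb fb hub hcof).
- rewrite gE (lt_trans _ (Tgt _))//.
  by rewrite (lt_act hrho).
- by rewrite gE -[ltRHS]wT (lt_act hrho) -(lt_act hrho f) (actKV hrho).
Qed.

Lemma oph_action_opp (R : realType) (G : groupType) (rho : G -> R -> R) :
  oph_action rho -> oph_action (fun g x => - rho g (- x)).
Proof.
move=> hrho; split.
- by apply/funext => x /=; rewrite (act1 hrho) opprK.
- by move=> g h; apply/funext => x /=; rewrite (actM hrho) opprK.
- move=> g; split.
  + exists (fun x => - rho g^-1%g (- x)) => x /=; rewrite opprK.
      by rewrite (actK hrho) opprK.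
    by rewrite (actKV hrho) opprK.
  + have [_ cont _] := let: And3 _ _ h := hrho in h g.
    move=> x; apply: (@cvgN _ R^o); apply: continuous_comp; last exact: cont.
    by apply: (@cvgN _ R^o); exact: cvg_id.
  + by move=> x y xy /=; rewrite ltrN2 (lt_act hrho) ltrN2.
Qed.

(** A fixed point to the left of [x] is brought to the right by the reflection of the line. As this
    reverses directions, the half already proved is applied to [f^-1] and [T^-1], at the point
    [- rho f x]. *)
Lemma fix_translate (R : realType) (G : groupType) (rho : G -> R -> R)
    (N : set G) (F : set R) (T : G) :
  oph_action rho -> loc_subexp_quot R N (pstab rho F) ->
  normal_in_G N -> closed F -> action_stable rho F ->
  (forall x, x < rho T x) ->
  forall f z x, N f -> F z -> rho f z = z -> F x -> rho f x <= rho T x.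
Proof.
move=> hrho growth nN cF sF Tgt f z x Nf Fz fz Fx.
have [xz|zx|->] := ltgtP x z; last by rewrite fz ltW.
  exact: (fix_translate_half hrho growth nN cF sF Tgt Nf Fz fz).
pose F' : set R := [set x | F (- x)].
have NV : N f^-1%g by case: nN => -[_ _ NV] _; exact: NV.
have pE : pstab (fun g x => - rho g (- x)) F' = pstab rho F.
  apply/seteqP; split=> g /= hg y Fy.
    by have := hg (- y); rewrite /F' /= opprK => /(_ Fy)/oppr_inj.
  by rewrite hg ?opprK.
have cF' : closed F'.
  have c : continuous (fun y => - y : R) by move=> y; apply: (@cvgN _ R^o); exact: cvg_id.
  by move/continuous_closedP : c; exact.
have sF' : action_stable (fun g x => - rho g (- x)) F'.
  by move=> g y Fy; rewrite /F' /= opprK; exact: sF.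
have Tgt' y : y < - rho T^-1%g (- y).
  by rewrite ltrNr -(lt_act hrho T) (actKV hrho).
have := @fix_translate_half R G (fun g x => - rho g (- x)) N F' T^-1%g
  (oph_action_opp hrho).
rewrite pE => /(_ growth nN cF' sF' Tgt' f^-1%g (- z) (- rho f x) NV).
rewrite /F' /= !opprK (actK hrho) ltrN2 lerN2 (act_fixV hrho fz).
move=> /(_ Fz erefl (sF _ _ Fx)) h.
rewrite -(le_act hrho T^-1%g) (actK hrho); apply: h.
by rewrite -[ltLHS]fz (lt_act hrho).
Qed.

Section FixedElements.
Context (R : realType) (G : groupType) (rho : G -> R -> R).
Hypothesis hrho : oph_action rho.
Context (N : set G) (F : set R) (T : G).
Hypotheses (growth : loc_subexp_quot R N (pstab rho F)) (nN : normal_in_G N).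
Hypotheses (cF : closed F) (sF : action_stable rho F).
Hypotheses (F0 : F !=set0) (Tgt : forall x, x < rho T x).

Definition fixing : set G := [set f | N f /\ exists2 z, F z & rho f z = z].

Definition fixing_locus : set R :=
  [set x | F x /\ forall f, fixing f -> rho f x = x].

Let grpN : is_subgroup N := proj1 nN.

Lemma fixingV f : fixing f -> fixing f^-1%g.
Proof.
move=> [Nf [z Fz fz]]; split; first by case: grpN => _ _; exact.
by exists z => //; exact: act_fixV.
Qed.

Lemma fixingX f n : fixing f -> fixing (f ^+ n)%g.
Proof.
move=> [Nf [z Fz fz]]; split; first exact: subgroup_expg.
by exists z => //; exact: act_fixX.
Qed.

Lemma fixing_le f x : fixing f -> F x -> rho f x <= rho T x.
Proof.
move=> [Nf [z Fz fz]] Fx.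
exact: (fix_translate hrho growth nN cF sF Tgt Nf Fz fz).
Qed.

(* Of the two limits of the orbits of [x] under [f] and [g], the larger one is
   fixed by both, for otherwise there would be a crossing. *)
Lemma fixing_common f g x : fixing f -> fixing g -> F x ->
  x <= rho f x -> x <= rho g x ->
  exists2 z, F z & rho f z = z /\ rho g z = z.
Proof.
move=> Kf Kg Fx.
have lim h (Kh : fixing h) := @orbit_lim _ _ _ hrho F h x (rho T x) cF sF Fx ^~
  (fun n => fixing_le (fixingX n Kh) Fx).
suff main f' g' b c : fixing f' -> fixing g' -> x <= rho f' x -> x <= rho g' x ->
    F b -> rho f' b = b -> (forall n, rho (f' ^+ n)%g x <= b) ->
    (forall y, y < b -> exists n, y < rho (f' ^+ n)%g x) ->
    (forall n, rho (g' ^+ n)%g x <= c) ->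
    (forall y, y < c -> exists n, y < rho (g' ^+ n)%g x) ->
    c <= b -> rho g' b = b.
  move=> xf xg; have [b [Fb fb ubb cob]] := lim f Kf xf.
  have [c [Fc gc ubc coc]] := lim g Kg xg.
  have [cb|/ltW bc] := leP c b.
    by exists b => //; split=> //; apply: (main f g b c).
  by exists c => //; split=> //; apply: (main g f c b).
move=> [Nf _] [Ng _] xf xg Fb fb ubb cob ubc coc cb.
have xb : x <= b by have := ubb 0%N; rewrite (act1 hrho).
have gb : x <= rho g' b by rewrite (le_trans xg)// (le_act hrho).
have gVb : x <= rho g'^-1%g b.
  by rewrite -(le_act hrho g') (actKV hrho) (le_trans (ubc 1%N)).
(* If [f'] fixes [x], no crossing arises: then [b = x], and [c <= b] forces [g'] to fix [x] as
   well. *)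
have := xf; rewrite le_eqVlt => /orP[/eqP fx|xf'].
  have bx : b <= x.
    rewrite leNgt; apply/negP => /cob[n].
    by rewrite (act_fixX hrho) -?fx// ltxx.
  have {bx} bx : b = x by apply: le_anti; rewrite bx xb.
  have := ubc 1%N; rewrite expg1 => /le_trans/(_ cb) gx.
  by move: gx; rewrite bx => gx; apply: le_anti; rewrite gx xg.
have fVx : rho f'^-1%g x < x by rewrite -(lt_act hrho f') (actKV hrho).
(* If [g'] moves [b], then [g'] or its inverse moves it to the left, to a point no further than [x]
   and hence beyond [f'^-1 x]: a crossing. *)
have [gb'|gb'|//] := ltgtP (rho g' b) b; exfalso.
  apply: (no_crossing hrho growth grpN Nf Ng xf' Fb fb ubb cob _ gb').
  exact: lt_le_trans gb.
have NgV : N g'^-1%g by case: grpN => _ _; exact.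
apply: (no_crossing hrho growth grpN Nf NgV xf' Fb fb ubb cob).
  exact: lt_le_trans gVb.
by rewrite -(lt_act hrho g') (actKV hrho).
Qed.

(** An element and its inverse have the same fixed points, so both factors may be assumed to move
    [x] to the right; a common fixed point is then fixed by the product. *)
Lemma fixingM f g : fixing f -> fixing g -> fixing (f * g)%g.
Proof.
move=> Kf Kg; split.
  by case: grpN => _ NM _; apply: NM; [case: Kf | case: Kg].
have [x Fx] := F0.
have pos h : fixing h -> exists2 h', fixing h' & x <= rho h' x /\
    (forall z, rho h' z = z -> rho h z = z).
  move=> Kh; have [xh|hx] := leP x (rho h x); first by exists h.
  exists h^-1%g; first exact: fixingV.
  split=> [|z /(act_fixV hrho)]; last by rewrite invgK.
  by rewrite -(le_act hrho h) (actKV hrho) ltW.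
have [f' Kf' [xf' ff']] := pos _ Kf; have [g' Kg' [xg' gg']] := pos _ Kg.
have [z Fz [fz gz]] := fixing_common Kf' Kg' Fx xf' xg'.
by exists z => //; rewrite (actM hrho) gg'// ff'.
Qed.

Lemma fixing_conj k f : fixing f -> fixing (k^-1 * f * k)%g.
Proof.
move=> [Nf [z Fz fz]]; split; first by case: nN => _; exact.
exists (rho k^-1%g z); first exact: sF.
by rewrite !(actM hrho) (actKV hrho) fz.
Qed.

(** Orbits of the subgroup [fixing] are bounded above by [T x], and the supremum of an orbit of a
    group is fixed by the group. *)
Lemma fixing_locus_nonempty : fixing_locus !=set0.
Proof.
have [x Fx] := F0; pose A := [set rho f x | f in fixing].
have K1 : fixing 1%g.
  by split; [case: grpN | exists x => //; rewrite (act1 hrho)].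
have A0 : A !=set0 by exists (rho 1%g x), 1%g.
have uA : has_ubound A by exists (rho T x) => _ [f Kf <-]; exact: fixing_le.
have supV f : fixing f -> rho f (sup A) <= sup A.
  move=> Kf; rewrite -[leRHS](actKV hrho f) (le_act hrho).
  apply: ge_sup => // _ [g Kg <-].
  rewrite -(le_act hrho f) (actKV hrho) -(actM hrho).
  by apply: ub_le_sup => //; exists (f * g)%g => //; exact: fixingM.
exists (sup A); split.
  by apply: closed_sup_mem => // _ [f _ <-]; exact: sF.
move=> f Kf; apply: le_anti; rewrite supV//=.
by rewrite -(le_act hrho f^-1%g) (actK hrho) supV//; exact: fixingV.
Qed.

Lemma fixing_locus_closed : closed fixing_locus.
Proof.
have -> : fixing_locus = F `&` \bigcap_(f in fixing) [set x | rho f x = x].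
  by apply/seteqP; split.
apply: closedI => //; apply: closed_bigI => f _; exact: closed_fixed.
Qed.

Lemma fixing_locus_stable : action_stable rho fixing_locus.
Proof.
move=> k x [Fx hx]; split; first exact: sF.
move=> f Kf; have := hx _ (fixing_conj k Kf); rewrite !(actM hrho) => e.
by rewrite -[RHS](congr1 (rho k) e) (actKV hrho).
Qed.

Lemma fixing_locus_fix g x y : N g -> F x -> rho g x = x -> fixing_locus y ->
  rho g y = y.
Proof. by move=> Ng Fx gx [_]; apply; split=> //; exists x. Qed.

(** A bounded orbit would converge to a fixed point of [g] in [F]; then [g] would belong to [fixing]
    and fix [x]. *)
Lemma fixing_locus_cofinal g x : N g -> fixing_locus x -> x < rho g x ->
  forall y, exists n, y < rho (g ^+ n)%g x.
Proof.
move=> Ng Lx xg y; apply: contrapT => /forallNP h.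
have hy n : rho (g ^+ n)%g x <= y by rewrite leNgt; apply/negP/h.
have [b [Fb gb _ _]] := orbit_lim hrho cF sF (proj1 Lx) (ltW xg) hy.
by move: xg; rewrite (fixing_locus_fix Ng Fb gb Lx) ltxx.
Qed.

(** If [g] fixes one point of the locus it fixes all. If it moves [u] to the right, the orbit of [u]
    is cofinal, and each point beyond [u] is carried past an orbit point; points before [u] are
    treated with [g^-1]. *)
Lemma fixing_locus_sign g x y : N g -> fixing_locus x -> fixing_locus y ->
  x <= rho g x -> y <= rho g y.
Proof.
move=> Ng Lx Ly; rewrite le_eqVlt => /orP[/eqP/esym gx|xg].
  by rewrite (fixing_locus_fix Ng (proj1 Lx) gx).
have step h u v : N h -> fixing_locus u -> u < rho h u -> u <= v -> v < rho h v.
  move=> Nh Lu uh uv.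
  have [n vn nmin] := ex_minnP (fixing_locus_cofinal Nh Lu uh v).
  case: n vn nmin => [|n] vn nmin; first by move: vn; rewrite (act1 hrho) ltNge uv.
  rewrite (lt_le_trans vn)// expgS (actM hrho) (le_act hrho) leNgt.
  by apply/negP => /nmin; rewrite ltnn.
have [xy|/ltW yx] := leP x y; first exact: ltW (step _ _ _ Ng Lx xg xy).
rewrite leNgt; apply/negP => gy.
have NgV : N g^-1%g by case: grpN => _ _; exact.
have yg : y < rho g^-1%g y by rewrite -(lt_act hrho g) (actKV hrho).
have := step _ _ _ NgV Ly yg yx; rewrite -(lt_act hrho g) (actKV hrho).
by rewrite ltNge ltW.
Qed.

End FixedElements.

(** * Hoelder's theorem *)

Definition zexpg {G : groupType} (f : G) (a : int) : G :=
  match a with Posz n => (f ^+ n)%g | Negz n => ((f ^+ n.+1)^-1)%g end.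

Section IntegerPowers.
Context (G : groupType).
Implicit Types (f g : G) (a b : int).

Lemma zexpg_add1 f a : zexpg f (a + 1) = (zexpg f a * f)%g.
Proof.
case: a => [n|[|n]]; first by rewrite -PoszD addn1 /= expgSr.
  by rewrite /= expg1 mulVg.
have -> : Negz n.+1 + 1 = Negz n by rewrite !NegzE; lia.
by rewrite /= [in RHS]expgS invgM -mulgA mulVg mulg1.
Qed.

Lemma zexpgD f a b : zexpg f (a + b) = (zexpg f a * zexpg f b)%g.
Proof.
elim: b => [|n IH|n IH]; first by rewrite addr0 /= mulg1.
  have -> : a + n.+1%:Z = (a + n%:Z) + 1 by lia.
  rewrite zexpg_add1 IH.
  have -> : n.+1%:Z = n%:Z + 1 by lia.
  by rewrite zexpg_add1 mulgA.
apply: (mulIg f); rewrite -zexpg_add1 -mulgA -zexpg_add1.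
have -> : a + - n.+1%:Z + 1 = a + - n%:Z by lia.
by have -> : - n.+1%:Z + 1 = - n%:Z by lia.
Qed.

Lemma zexpgK f a : (zexpg f (- a) * zexpg f a = 1)%g.
Proof. by rewrite -zexpgD addNr. Qed.

Lemma zexpgX f a n : (zexpg f a ^+ n)%g = zexpg f (a * n%:Z).
Proof.
elim: n => [|n IH]; first by rewrite mulr0.
by rewrite expgS IH -zexpgD; congr zexpg; lia.
Qed.

Lemma zexpg_mem (N : set G) f a : is_subgroup N -> N f -> N (zexpg f a).
Proof.
move=> grpN Nf; case: a => n /=; first exact: subgroup_expg.
by case: (grpN) => _ _; apply; exact: subgroup_expg.
Qed.

(** Replacing a factor [g h] by [h g] increases a product, and the two outer terms are the fully
    sorted words. The relation is abstract so that the lemma also applies to the converse order. *)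
Lemma expg_sandwich (le : G -> G -> Prop) g h n :
  (forall x, le x x) -> (forall x y z, le x y -> le y z -> le x z) ->
  (forall x y z t, le x y -> le z t -> le (x * z)%g (y * t)%g) ->
  le (g * h)%g (h * g)%g ->
  le (g ^+ n * h ^+ n)%g ((g * h) ^+ n)%g /\
  le ((g * h) ^+ n)%g (h ^+ n * g ^+ n)%g.
Proof.
move=> refl trans comp gh.
have comm m : le (g ^+ m * h)%g (h * g ^+ m)%g.
  elim: m => [|m IH]; first by rewrite !(mul1g, mulg1).
  rewrite expgS -mulgA; apply: trans (comp _ _ _ _ (refl g) IH) _.
  rewrite mulgA [X in le _ X]mulgA.
  exact: comp.
elim: n => [|n [IH1 IH2]]; first by rewrite !mul1g.
split.
  have -> : (g ^+ n.+1 * h ^+ n.+1 = g * (g ^+ n * h) * h ^+ n)%g.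
    by rewrite !expgS !mulgA.
  apply: trans (comp _ _ _ _ (comp _ _ _ _ (refl g) (comm n)) (refl _)) _.
  rewrite expgS -!mulgA [X in le _ X]mulgA mulgA.
  by apply: comp.
have -> : (h ^+ n.+1 * g ^+ n.+1 = h ^+ n * (h * g ^+ n.+1))%g.
  by rewrite mulgA -expgSr.
apply: trans (comp _ _ _ _ (refl _) (comm _)).
rewrite expgSr [in X in le _ X]expgSr -!mulgA [X in le _ X]mulgA.
exact: comp.
Qed.

End IntegerPowers.

(** Turns approximations with an error bounded independently of [n] into equalities. *)
Lemma archi_eq0 (R : realType) (t C : R) :
  (forall n, n%:R * `|t| <= C) -> t = 0.
Proof.
move=> h; apply/eqP; apply: contrapT => /negP; rewrite -normr_gt0 => t0.
have := h (Num.bound (C / `|t|)); rewrite leNgt => /negP; apply.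
rewrite -ltr_pdivrMr//; apply: archi_boundP; apply: divr_ge0 => //.
by have := h 0%N; rewrite mul0r.
Qed.

(** A semiconjugacy to an affine action. Nonconstancy will make the Stieltjes measure nonzero, and
    the slopes [lam] will be its factors of quasi-invariance. *)
Definition affine_on {R : realType} {G : groupType} (rho : G -> R -> R)
    (H : set G) (phi : R -> R) : Prop :=
  [/\ {homo phi : x y / x <= y}, exists x y, phi x < phi y
    & forall k, H k -> exists lam c, 0 <= lam /\
        forall x, phi (rho k x) = lam * phi x + c].

(** * The Archimedean order on [N] given by its action on [X] *)

Section Hoelder.
Context (R : realType) (G : groupType) (rho : G -> R -> R).
Hypothesis hrho : oph_action rho.
Context (N : set G) (X : set R) (x0 : R).
Hypotheses (nN : normal_in_G N) (sX : action_stable rho X).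
Hypothesis sgn : forall g x y, N g -> X x -> X y -> x <= rho g x -> y <= rho g y.
Hypothesis cof : forall g x, N g -> X x -> x < rho g x ->
  forall y, exists n, y < rho (g ^+ n)%g x.
Hypothesis unb : forall y, exists2 x, X x & x < y.
Hypothesis Xx0 : X x0.

Let grpN : is_subgroup N := proj1 nN.
Let NM g h : N g -> N h -> N (g * h)%g. Proof. by case: grpN => _ h' _; exact: h'. Qed.
Let NV g : N g -> N (g^-1)%g. Proof. by case: grpN => _ _; exact. Qed.
Let N1 : N 1%g. Proof. by case: grpN. Qed.
Let NX g n : N g -> N (g ^+ n)%g. Proof. exact: subgroup_expg. Qed.
Let Nz g a : N g -> N (zexpg g a). Proof. exact: zexpg_mem. Qed.
Let NJ k g : N g -> N (k * g * k^-1)%g.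
Proof. by move=> Ng; have := proj2 nN (k^-1)%g _ Ng; rewrite invgK. Qed.

(** On [N], a comparison at one point of [X] extends to all of [X] by [sgn]; hence this is a total
    bi-invariant preorder there, and [cof] makes it Archimedean. *)
Definition leN g h := forall x, X x -> rho g x <= rho h x.

Lemma leN_refl g : leN g g. Proof. by []. Qed.

Lemma leN_trans g h k : leN g h -> leN h k -> leN g k.
Proof. by move=> gh hk x Xx; rewrite (le_trans (gh _ Xx))// hk. Qed.

Lemma leN_mul g h g' h' : leN g h -> leN g' h' -> leN (g * g')%g (h * h')%g.
Proof.
move=> gh gh' x Xx; rewrite !(actM hrho) (@le_trans _ _ (rho g (rho h' x)))//.
  by rewrite (le_act hrho) gh'.
by rewrite gh//; exact: sX.
Qed.

Lemma leNP g h x : N g -> N h -> X x -> rho g x <= rho h x -> leN g h.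
Proof.
move=> Ng Nh Xx gh y Xy.
rewrite -(le_act hrho g^-1%g) (actK hrho) -(actM hrho).
apply: (sgn (NM (NV Ng) Nh) Xx Xy).
by rewrite -(le_act hrho g) (actM hrho) (actKV hrho).
Qed.

Lemma leN_total g h : N g -> N h -> leN g h \/ leN h g.
Proof.
move=> Ng Nh; have [gh|/ltW hg] := leP (rho g x0) (rho h x0).
  by left; exact: leNP Xx0 gh.
by right; exact: leNP Xx0 hg.
Qed.

Lemma leN_exp g h n : leN g h -> leN (g ^+ n)%g (h ^+ n)%g.
Proof. by move=> gh; elim: n => // n IH; rewrite !expgS; exact: leN_mul. Qed.

Lemma gt_act g x : N g -> x0 < rho g x0 -> X x -> x < rho g x.
Proof.
move=> Ng xg Xx; rewrite ltNge; apply/negP => gx.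
have := sgn (NV Ng) Xx Xx0; rewrite -(le_act hrho g) (actKV hrho) => /(_ gx).
by rewrite -(le_act hrho g) (actKV hrho) leNgt xg.
Qed.

Lemma zexpg_lt g a b x : N g -> x0 < rho g x0 -> X x -> a < b ->
  rho (zexpg g a) x < rho (zexpg g b) x.
Proof.
move=> Ng xg Xx ab; have [n ->] : exists n, b = a + n.+1%:Z.
  by exists (`|b - a|.-1)%N; lia.
rewrite zexpgD (actM hrho) (lt_act hrho) /= expgSr (actM hrho).
rewrite (lt_le_trans (gt_act Ng xg Xx))//.
elim: n => [|n IH]; first by rewrite (act1 hrho).
rewrite (le_trans IH)// expgS (actM hrho) ltW//.
by apply: gt_act => //; do 2!apply: sX.
Qed.

Lemma zexpg_leN g a b : N g -> x0 < rho g x0 -> leN (zexpg g a) (zexpg g b) ->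
  a <= b.
Proof.
move=> Ng xg h; rewrite leNgt; apply/negP => /(zexpg_lt Ng xg Xx0).
by rewrite ltNge h.
Qed.

(** Cofinality only bounds orbits to the right. For the lower bound, a point [x1] of [X] to the left
    of [y] is carried past [x0] by some [g ^+ n], so that [g^-n x0 < x1]. *)
Lemma zexpg_floor g y : N g -> x0 < rho g x0 ->
  exists a, rho (zexpg g a) x0 <= y < rho (zexpg g (a + 1)) x0.
Proof.
move=> Ng xg; have [x1 Xx1 x1y] := unb y.
have [n hn] := cof Ng Xx1 (gt_act Ng xg Xx1) x0.
have ny : rho (zexpg g (- n%:Z)) x0 < y.
  apply: lt_trans x1y; rewrite -[ltRHS](act1 hrho) -(zexpgK g n%:Z) (actM hrho).
  by rewrite (lt_act hrho).
have XX : X (rho (zexpg g (- n%:Z)) x0) by exact: sX.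
have [m hm mmin] := ex_minnP (cof Ng XX (gt_act Ng xg XX) y).
case: m hm mmin => [|m] hm mmin; first by move: hm; rewrite (act1 hrho) ltNge ltW.
exists (m%:Z - n%:Z); apply/andP; split.
  rewrite leNgt zexpgD (actM hrho); apply/negP => /mmin; by rewrite ltnn.
have -> : m%:Z - n%:Z + 1 = m.+1%:Z - n%:Z by lia.
by rewrite zexpgD (actM hrho).
Qed.

(** * Translation numbers with unit [f] *)

Context (f : G).
Hypotheses (Nf : N f) (f_gt : x0 < rho f x0).

Lemma zexpg_approx g : N g -> exists a,
  leN (zexpg f a) g /\ leN g (zexpg f (a + 1)).
Proof.
move=> Ng; have [a /andP[h1 h2]] := zexpg_floor (rho g x0) Nf f_gt.
exists a; split; first exact: leNP (Nz _ Nf) Ng Xx0 h1.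
exact: leNP Ng (Nz _ Nf) Xx0 (ltW h2).
Qed.

(** The Dedekind cut that Hoelder's theorem attaches to [g]: a fraction [a / n.+1] lies below it
    when [f ^ a] is below [g ^ n.+1]. *)
Definition transl (g : G) : R :=
  sup [set r | exists a n, leN (zexpg f a) (g ^+ n.+1)%g /\ r = a%:~R / n.+1%:R].

(** Raising the hypotheses to the powers [m] and [n] compares two powers of [f]. *)
Lemma transl_cut g a b n m : leN (zexpg f a) (g ^+ n)%g ->
  leN (g ^+ m)%g (zexpg f b) -> a * m%:Z <= b * n%:Z.
Proof.
move=> h1 h2; apply: (zexpg_leN Nf f_gt).
rewrite -!zexpgX; apply: leN_trans (leN_exp m h1) _.
by rewrite -expgnA mulnC expgnA; exact: leN_exp.
Qed.

Lemma transl_ge g a n : N g -> leN (zexpg f a) (g ^+ n)%g -> a%:~R <= n%:R * transl g.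
Proof.
case: n => [|n] Ng h.
  by rewrite mul0r -[0]/(0%:~R) ler_int; apply: (zexpg_leN Nf f_gt).
rewrite mulrC -ler_pdivrMr ?ltr0n//; apply: ub_le_sup; last by exists a, n.
have [b [_ hb]] := zexpg_approx Ng.
exists (b + 1)%:~R => _ [c [m [hc ->]]].
rewrite ler_pdivrMr ?ltr0n// -[m.+1%:R]/(m.+1%:~R) -intrM ler_int.
by have := transl_cut hc (m := 1) hb; rewrite mulr1.
Qed.

Lemma transl_le g a n : N g -> leN (g ^+ n)%g (zexpg f a) -> n%:R * transl g <= a%:~R.
Proof.
case: n => [|n] Ng h.
  by rewrite mul0r -[0]/(0%:~R) ler_int; apply: (zexpg_leN Nf f_gt).
rewrite mulrC -ler_pdivlMr ?ltr0n//; apply: ge_sup.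
  by have [b [hb _]] := zexpg_approx Ng; exists (b%:~R / 1%:R), b, 0%N.
move=> _ [c [m [hc ->]]].
rewrite ler_pdivrMr ?ltr0n// mulrAC ler_pdivlMr ?ltr0n//.
by rewrite -![_.+1%:R]/(_.+1%:~R) -!intrM ler_int; exact: transl_cut h.
Qed.

(** If [f ^ a <= g ^ n <= f ^ (a + 1)], and likewise for [h] with [b], then both orders of the
    product of [g ^ n] and [h ^ n] lie between [f ^ (a + b)] and [f ^ (a + b + 2)]. By
    [expg_sandwich] so does [(g h) ^ n], and [n] times the defect is at most 2. *)
Lemma translM g h : N g -> N h -> transl (g * h)%g = transl g + transl h.
Proof.
move=> Ng Nh; apply/eqP; rewrite -subr_eq0; apply/eqP.
apply: (@archi_eq0 _ _ 2) => n.
have [a [a1 a2]] := zexpg_approx (NX n Ng).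
have [b [b1 b2]] := zexpg_approx (NX n Nh).
have gh1 : leN (zexpg f (a + b)) (g ^+ n * h ^+ n)%g.
  by rewrite zexpgD; exact: leN_mul.
have gh2 : leN (g ^+ n * h ^+ n)%g (zexpg f (a + 1 + (b + 1))).
  by rewrite zexpgD; exact: leN_mul.
have hg1 : leN (zexpg f (a + b)) (h ^+ n * g ^+ n)%g.
  by rewrite addrC zexpgD; exact: leN_mul.
have hg2 : leN (h ^+ n * g ^+ n)%g (zexpg f (a + 1 + (b + 1))).
  by rewrite addrC zexpgD; exact: leN_mul.
have [l1 l2] : leN (zexpg f (a + b)) ((g * h) ^+ n)%g /\
    leN ((g * h) ^+ n)%g (zexpg f (a + 1 + (b + 1))).
  have [gh|hg] := leN_total (NM Ng Nh) (NM Nh Ng).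
    have [s1 s2] := expg_sandwich n leN_refl leN_trans leN_mul gh.
    by split; [exact: leN_trans s1 | exact: leN_trans hg2].
  have [||s1 s2] := @expg_sandwich _ (fun x y => leN y x) g h n leN_refl _ _ hg.
    by move=> x y z xy yz; exact: leN_trans xy.
    by move=> x y z t; exact: leN_mul.
  by split; [exact: leN_trans s2 | exact: leN_trans gh2].
have := transl_ge (NM Ng Nh) l1; have := transl_le (NM Ng Nh) l2.
have := transl_ge Ng a1; have := transl_le Ng a2.
have := transl_ge Nh b1; have := transl_le Nh b2.
rewrite !intrD -[X in X * `|_|](ger0_norm (ler0n _ n)) -normrM mulrBr mulrDr.
by move=> *; rewrite ler_norml; apply/andP; split; lra.
Qed.

Lemma transl_f : transl f = 1.
Proof.
apply: le_anti.
have := @transl_le f 1 1 Nf (leN_refl f); have := @transl_ge f 1 1 Nf (leN_refl f).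
by rewrite !mul1r => -> ->.
Qed.

Lemma transl_leN g h : N g -> N h -> leN g h -> transl g <= transl h.
Proof.
move=> Ng Nh gh; rewrite -subr_le0; apply: contrapT => /negP; rewrite -ltNge => t0.
suff : transl g - transl h = 0 by move=> e; rewrite e ltxx in t0.
apply: (@archi_eq0 _ _ 1) => n; rewrite gtr0_norm//.
have [a [a1 a2]] := zexpg_approx (NX n Nh).
have := transl_le Ng (leN_trans (leN_exp n gh) a2); have := transl_ge Nh a1.
by rewrite intrD mulrBr => *; lra.
Qed.

Lemma additive1 (sigma : G -> R) :
  (forall g h, N g -> N h -> sigma (g * h)%g = sigma g + sigma h) -> sigma 1%g = 0.
Proof. by move=> sM; have := sM _ _ N1 N1; rewrite mulg1 => e; lra. Qed.

Lemma additiveV (sigma : G -> R) g : N g ->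
  (forall g h, N g -> N h -> sigma (g * h)%g = sigma g + sigma h) ->
  sigma g^-1%g = - sigma g.
Proof.
move=> Ng sM; have := sM _ _ Ng (NV Ng).
by rewrite mulgV additive1// => e; lra.
Qed.

Lemma additiveX (sigma : G -> R) g n : N g ->
  (forall g h, N g -> N h -> sigma (g * h)%g = sigma g + sigma h) ->
  sigma (g ^+ n)%g = n%:R * sigma g.
Proof.
move=> Ng sM; elim: n => [|n IH]; first by rewrite mul0r additive1.
by rewrite expgS sM ?IH -?[n.+1]addn1 ?natrD; [ring | | exact: NX].
Qed.

Lemma additive_zexpg (sigma : G -> R) g a : N g ->
  (forall g h, N g -> N h -> sigma (g * h)%g = sigma g + sigma h) ->
  sigma (zexpg g a) = a%:~R * sigma g.
Proof.
move=> Ng sM; case: a => n; first by rewrite /= additiveX.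
by rewrite /= additiveV ?additiveX// ?NegzE ?mulrNz ?mulNr//; exact: NX.
Qed.

(** The uniqueness part of Hoelder's theorem: trapping [g ^ n] between consecutive powers of [f]
    leaves an error of at most [sigma f]. *)
Lemma additive_proportional (sigma : G -> R) :
  (forall g h, N g -> N h -> sigma (g * h)%g = sigma g + sigma h) ->
  (forall g h, N g -> N h -> leN g h -> sigma g <= sigma h) ->
  0 <= sigma f /\ forall g, N g -> sigma g = sigma f * transl g.
Proof.
move=> sM sle.
have s0 : 0 <= sigma f.
  rewrite -(additive1 sM); apply: sle => //.
  by apply: (leNP N1 Nf Xx0); rewrite (act1 hrho) ltW.
split=> // g Ng; apply/eqP; rewrite -subr_eq0; apply/eqP.
apply: (@archi_eq0 _ _ (sigma f)) => n.
have [a [a1 a2]] := zexpg_approx (NX n Ng).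
have := sle _ _ (NX n Ng) (Nz _ Nf) a2; have := sle _ _ (Nz _ Nf) (NX n Ng) a1.
have := ler_wpM2l s0 (transl_ge Ng a1); have := ler_wpM2l s0 (transl_le Ng a2).
rewrite !additive_zexpg// !additiveX// !intrD.
rewrite -[X in X * `|_|](ger0_norm (ler0n _ n)) -normrM mulrBr.
by move=> *; rewrite ler_norml; apply/andP; split; lra.
Qed.

(** Conjugation by [k] is multiplicative and preserves the order, so uniqueness applies. The factor
    is the translation number of [k f k^-1]. *)
Lemma transl_conj k : exists2 lam, 0 <= lam &
  forall g, N g -> transl (k * g * k^-1)%g = lam * transl g.
Proof.
have [|g h Ng Nh gh|l0 hl] := @additive_proportional (fun g => transl (k * g * k^-1)%g).
- move=> g h Ng Nh; rewrite -translM; [|exact: NJ|exact: NJ].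
  by congr transl; rewrite -!mulgA mulKg.
- apply: transl_leN; [exact: NJ|exact: NJ|].
  by do 2!apply: leN_mul => //.
- by exists (transl (k * f * k^-1)%g).
Qed.

(** Extends the assignment of [transl g] to the orbit point [g x0] to a monotone function on the
    whole line. *)
Definition hoelder_map (x : R) : R :=
  sup [set transl g | g in [set g | N g /\ rho g x0 <= x]].

Lemma hoelder_map_ge g x : N g -> rho g x0 <= x -> transl g <= hoelder_map x.
Proof.
move=> Ng gx; apply: ub_le_sup; last by exists g.
have [a /andP[_ h]] := zexpg_floor x Nf f_gt.
exists (transl (zexpg f (a + 1))) => _ [h' [Nh hx] <-].
apply: transl_leN => //; first exact: Nz.
exact: leNP Nh (Nz _ Nf) Xx0 (le_trans hx (ltW h)).
Qed.

Lemma hoelder_map_lub x r : (forall g, N g -> rho g x0 <= x -> transl g <= r) ->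
  hoelder_map x <= r.
Proof.
move=> h; apply: ge_sup; last by move=> _ [g [Ng gx] <-]; exact: h.
have [a /andP[ha _]] := zexpg_floor x Nf f_gt.
by exists (transl (zexpg f a)), (zexpg f a) => //; split=> //; exact: Nz.
Qed.

Lemma hoelder_map_le g x : N g -> x <= rho g x0 -> hoelder_map x <= transl g.
Proof.
move=> Ng gx; apply: hoelder_map_lub => h Nh hx.
by apply: transl_leN => //; exact: leNP Nh Ng Xx0 (le_trans hx gx).
Qed.

Lemma hoelder_map_homo : {homo hoelder_map : x y / x <= y}.
Proof.
move=> x y xy; apply: hoelder_map_lub => g Ng gx.
exact: hoelder_map_ge Ng (le_trans gx xy).
Qed.

Lemma hoelder_map_nonconstant : hoelder_map x0 < hoelder_map (rho f x0).
Proof.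
have h1 : hoelder_map x0 <= transl 1%g.
  by apply: hoelder_map_le => //; rewrite (act1 hrho).
have h2 := hoelder_map_ge Nf (lexx (rho f x0)).
by move: h1 h2; rewrite transl_f (additive1 translM) => *; lra.
Qed.

(** If [g x0 <= k y] then [k^-1 g x0 <= y], which gives one inequality; the other is the same one
    for [h^-1]. *)
Lemma hoelder_mapJ h x : N h -> hoelder_map (rho h x) = hoelder_map x + transl h.
Proof.
have main k y : N k -> hoelder_map (rho k y) <= hoelder_map y + transl k.
  move=> Nk; apply: hoelder_map_lub => g Ng gx.
  have := @hoelder_map_ge (k^-1 * g)%g y (NM (NV Nk) Ng).
  rewrite -(le_act hrho k) (actM hrho) (actKV hrho) => /(_ gx).
  by rewrite translM// ?(additiveV _ translM)//; [lra | exact: NV].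
move=> Nh; apply: le_anti; rewrite main//=.
have := main _ (rho h x) (NV Nh).
by rewrite (actK hrho) (additiveV _ translM)// => *; lra.
Qed.

Lemma hoelder_affine : affine_on rho N hoelder_map.
Proof.
split; first exact: hoelder_map_homo.
  by exists x0, (rho f x0); exact: hoelder_map_nonconstant.
move=> k Nk; exists 1, (transl k); split=> // x.
by rewrite hoelder_mapJ// mul1r.
Qed.

(* The translation numbers are dense, so the map is determined up to an affine
   change of coordinates by its equivariance under [N]. *)
Lemma hoelder_affine_dense :
  (forall g, N g -> x0 < rho g x0 -> exists2 h, N h & x0 < rho h x0 < rho g x0) ->
  affine_on rho setT hoelder_map.
Proof.
move=> dense; split; first exact: hoelder_map_homo.
  by exists x0, (rho f x0); exact: hoelder_map_nonconstant.
have small n : exists h, [/\ N h, x0 < rho h x0 & n%:R * transl h <= 1].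
  (* Halving: if [h'] moves [x0] less far than [h], then [h'] or [h'^-1 h] has at most half the
     translation number of [h]. *)
  suff [h [Nh xh hn]] : exists h, [/\ N h, x0 < rho h x0 & 2 ^+ n * transl h <= 1].
    have h0 : 0 <= transl h.
      rewrite -(additive1 translM); apply: transl_leN => //.
      by apply: (leNP N1 Nh Xx0); rewrite (act1 hrho) ltW.
    exists h; split=> //; apply: le_trans hn; apply: ler_wpM2r => //.
    by rewrite -natrX ler_nat ltnW// ltn_expl.
  elim: n => [|n [h [Nh xh hn]]]; first by exists f; rewrite transl_f mulr1.
  have [h' Nh' /andP[xh' h'h]] := dense _ Nh xh.
  pose h'' := (h'^-1 * h)%g.
  have Nh'' : N h'' by exact: NM (NV Nh') Nh.
  have xh'' : x0 < rho h'' x0.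
    by rewrite -(lt_act hrho h') (actM hrho) (actKV hrho).
  have e : transl h = transl h' + transl h'' by rewrite -{1}[h](mulVKg h') translM.
  have half t : 2 * t <= transl h -> 2 ^+ n.+1 * t <= 1.
    move=> ht; apply: le_trans hn; rewrite exprSr -mulrA.
    by apply: ler_wpM2l => //; exact: exprn_ge0.
  have [le1|le2] := leP (transl h') (transl h'').
    by exists h'; split=> //; apply: half; rewrite e mulrDl mul1r lerD2l.
  exists h''; split=> //; apply: half; rewrite e mulrDl mul1r lerD2r; exact: ltW.
move=> k _; have [lam lam0 hlam] := transl_conj k.
exists lam, (hoelder_map (rho k x0)); split=> // x.
(* On the orbit of [x0] the formula is exact, since [k g x0 = (k g k^-1) (k x0)]. *)
have kE g : N g -> hoelder_map (rho k (rho g x0)) =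
    lam * transl g + hoelder_map (rho k x0).
  move=> Ng; rewrite -(hlam _ Ng) addrC -hoelder_mapJ; last exact: NJ.
  by rewrite !(actM hrho) (actK hrho).
(* Between consecutive points [h ^ a x0] and [h ^ (a + 1) x0] around [x], both sides vary by at most
   [lam * transl h], and [n * transl h <= 1]. *)
apply/eqP; rewrite -subr_eq0; apply/eqP; apply: (@archi_eq0 _ _ lam) => n.
have [h [Nh xh hn]] := small n.
have [a /andP[/[dup] l1 l1' /ltW/[dup] l2 l2']] := zexpg_floor x Nh xh.
move: l1' l2'; rewrite -(le_act hrho k) -[in X in _ -> X -> _](le_act hrho k).
move=> /hoelder_map_homo + /hoelder_map_homo.
have Na := Nz a Nh; have Na1 := Nz (a + 1) Nh.
rewrite !kE// => k1 k2.
have := ler_wpM2l lam0 (hoelder_map_ge Na l1).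
have := ler_wpM2l lam0 (hoelder_map_le Na1 l2).
move: k1 k2; rewrite !(additive_zexpg _ _ translM)// intrD mulrDl !mulrDr mul1r.
move=> k1 k2 k3 k4.
apply: le_trans (_ : n%:R * (lam * transl h) <= _); last first.
  by rewrite mulrCA -[leRHS]mulr1; exact: ler_wpM2l.
apply: ler_wpM2l => //; rewrite ler_norml; apply/andP; split; lra.
Qed.

End Hoelder.

(** * Descent along the filtration *)

(** The square of Bernoulli's inequality for [r] is a quadratic lower bound, which beats the linear
    term. *)
Lemma linear_le_exp (R : realType) (r : R) (A : nat) : 1 < r ->
  exists n0, forall n, (n0 <= n)%N -> (A * n.+1)%:R <= (r ^+ 2) ^+ n.
Proof.
move=> r1; pose d := r - 1; have d0 : 0 < d by rewrite subr_gt0.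
have bern n : 1 + n%:R * d <= r ^+ n.
  elim: n => [|n IH]; first by rewrite mul0r addr0.
  rewrite exprS -natr1; apply: le_trans (_ : r * (1 + n%:R * d) <= _); last first.
    by rewrite ler_pM2l// (lt_trans ltr01).
  have -> : r = 1 + d by rewrite /d; lra.
  have : 0 <= n%:R * d * d by rewrite !mulr_ge0// ltW.
  by move=> *; nra.
pose B := 2 * A%:R / d ^+ 2.
have B0 : 0 <= B by apply: divr_ge0; [apply: mulr_ge0|apply: exprn_ge0; exact: ltW].
(* Beyond [B] one has [2 A <= n d ^ 2]; the successor also gives [1 <= n], hence
   [A (n + 1) <= 2 A n]. *)
exists (Num.bound B).+1 => n hn.
have Bn : 2 * A%:R <= n%:R * d ^+ 2.
  rewrite -ler_pdivrMr ?exprn_gt0//; apply: ltW; apply: lt_trans (archi_boundP B0) _.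
  by rewrite ltr_nat.
have n1 : 1 <= n%:R :> R by rewrite ler1n (leq_trans _ hn).
rewrite -exprM [(2 * n)%N]mulnC exprM.
apply: le_trans (_ : (n%:R * d) ^+ 2 <= _); last first.
  have h1 : 0 <= n%:R * d by apply: mulr_ge0 => //; exact: ltW.
  have h2 : 0 <= r ^+ n by apply: exprn_ge0; rewrite ltW// (lt_trans ltr01).
  by rewrite ler_pXn2r ?nnegrE// (le_trans _ (bern n))// lerDr.
rewrite exprMn natrM -natr1.
apply: le_trans (_ : n%:R * (2 * A%:R) <= _); last first.
  by rewrite [n%:R ^+ 2]expr2 -mulrA; apply: ler_wpM2l.
have A0 : 0 <= A%:R :> R by [].
by nra.
Qed.

(** * The discrete case: [f] realizes the least positive displacement of [x0] *)

Section DiscreteStep.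
Context (R : realType) (G : groupType) (rho : G -> R -> R).
Hypothesis hrho : oph_action rho.
Context (N : set G) (X : set R) (f : G) (x0 : R).
Hypotheses (nN : normal_in_G N) (sX : action_stable rho X).
Hypothesis sgn : forall g x y, N g -> X x -> X y -> x <= rho g x -> y <= rho g y.
Hypothesis cof : forall g x, N g -> X x -> x < rho g x ->
  forall y, exists n, y < rho (g ^+ n)%g x.
Hypothesis unb : forall y, exists2 x, X x & x < y.
Hypotheses (Nf : N f) (Xx0 : X x0) (f_gt : x0 < rho f x0).
Hypothesis f_min : forall h, N h -> x0 < rho h x0 -> rho f x0 <= rho h x0.

Let grpN : is_subgroup N := proj1 nN.
Let NM g h : N g -> N h -> N (g * h)%g. Proof. by case: grpN => _ h' _; exact: h'. Qed.
Let NV g : N g -> N (g^-1)%g. Proof. by case: grpN => _ _; exact. Qed.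
Let Nz a : N (zexpg f a). Proof. exact: zexpg_mem. Qed.
Let leP0 g h x (Ng : N g) (Nh : N h) (Xx : X x) := leNP hrho nN sgn Ng Nh Xx.

Lemma minimal_le x h : X x -> N h -> x < rho h x -> rho f x <= rho h x.
Proof.
move=> Xx Nh xh; apply: (leP0 Nf Nh Xx0) => //.
by apply: f_min => //; apply: (gt_act hrho nN sgn Xx Nh xh).
Qed.

(** The conjugates of [f] by [k] and by [k^-1] lie in [N] and move points of [X] to the right, so by
    minimality neither moves a point less far than [f]. *)
Lemma minimal_central k x : X x -> rho k (rho f x) = rho f (rho k x).
Proof.
move=> Xx; have xf y : X y -> y < rho f y by apply: (gt_act hrho nN sgn Xx0).
apply: le_anti; apply/andP; split.
  have := @minimal_le x (k^-1 * f * k)%g Xx; rewrite !(actM hrho).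
  rewrite -(le_act hrho k) (actKV hrho); apply; first exact: (proj2 nN).
  by rewrite -(lt_act hrho k) (actKV hrho) xf//; exact: sX.
have := @minimal_le (rho k x) (k^-1^-1 * f * k^-1)%g (sX k Xx).
rewrite invgK !(actM hrho) (actK hrho); apply; last by rewrite (lt_act hrho) xf.
by rewrite -{1}[k]invgK; exact: (proj2 nN).
Qed.

Lemma minimal_centralX k n x : X x ->
  rho k (rho (f ^+ n)%g x) = rho (f ^+ n)%g (rho k x).
Proof.
move=> Xx; elim: n => [|n IH]; first by rewrite !(act1 hrho).
rewrite expgS !(actM hrho) minimal_central ?IH//.
exact: sX.
Qed.

Lemma minimal_central_zexpg k a x : X x ->
  rho k (rho (zexpg f a) x) = rho (zexpg f a) (rho k x).
Proof.
move=> Xx; case: a => n /=; first exact: minimal_centralX.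
apply: (act_inj hrho (g := (f ^+ n.+1)%g)).
rewrite (actKV hrho) -minimal_centralX ?(actKV hrho)//.
exact: sX.
Qed.

(** Division with remainder: the remainder [f ^ (- a) * h] fixes [x0] by minimality, and then all of
    [X] by [sgn]. *)
Lemma minimal_generates h : N h -> exists a, forall x, X x ->
  rho h x = rho (zexpg f a) x.
Proof.
move=> Nh.
have [a /andP[h1 h2]] := zexpg_floor hrho nN sX sgn cof unb Xx0 (rho h x0) Nf f_gt.
exists a => x Xx; pose u := (zexpg f (- a) * h)%g.
have Nu : N u by exact: NM.
have ua y : rho (zexpg f a) (rho u y) = rho h y.
  by rewrite -(actM hrho) mulgA -zexpgD subrr mul1g.
have u1 : x0 <= rho u x0 by rewrite -(le_act hrho (zexpg f a)) ua.
have u2 : rho u x0 <= x0.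
  rewrite leNgt; apply/negP => /(f_min Nu); rewrite -(le_act hrho (zexpg f a)) ua.
  by rewrite leNgt -(actM hrho) -zexpg_add1 h2.
have uV : x0 <= rho u^-1%g x0 by rewrite -(le_act hrho u) (actKV hrho).
have := sgn (NV Nu) Xx0 Xx uV; rewrite -(le_act hrho u) (actKV hrho) => u3.
have ux : rho u x = x by apply: le_anti; rewrite u3 (sgn Nu Xx0 Xx u1).
by rewrite -ua ux.
Qed.

(** A length in units of [f]. Centrality makes it subadditive, so it grows at most linearly on
    balls. *)
Definition displaced_by (D : nat) (s : G) : Prop :=
  rho s x0 <= rho (zexpg f D%:Z) x0 /\ rho (zexpg f (- D%:Z)) x0 <= rho s x0.

Let zle a b : rho (zexpg f a) x0 <= rho (zexpg f b) x0 -> a <= b.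
Proof. by move=> h; apply: (zexpg_leN hrho nN sX sgn Xx0 Nf f_gt); exact: leP0 h. Qed.

Let lez a b : a <= b -> rho (zexpg f a) x0 <= rho (zexpg f b) x0.
Proof.
rewrite le_eqVlt => /predU1P[->//|ab].
exact: ltW (zexpg_lt hrho nN sX sgn Xx0 Nf f_gt Xx0 ab).
Qed.

Lemma displaced_by_mono D D' s : (D <= D')%N -> displaced_by D s -> displaced_by D' s.
Proof.
move=> DD [h1 h2]; split; first by apply: le_trans h1 _; apply: lez; lia.
by apply: le_trans h2; apply: lez; lia.
Qed.

Lemma displaced_byM D D' s w : displaced_by D s -> displaced_by D' w ->
  displaced_by (D + D') (s * w)%g.
Proof.
move=> [s1 s2] [w1 w2]; rewrite /displaced_by (actM hrho); split.
  apply: le_trans (_ : rho s (rho (zexpg f D'%:Z) x0) <= _).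
    by rewrite (le_act hrho).
  by rewrite minimal_central_zexpg// PoszD addrC zexpgD (actM hrho) (le_act hrho).
apply: le_trans (_ : rho s (rho (zexpg f (- D'%:Z)) x0) <= _); last first.
  by rewrite (le_act hrho).
by rewrite minimal_central_zexpg// PoszD opprD addrC zexpgD (actM hrho) (le_act hrho).
Qed.

Lemma displaced_byV D s : displaced_by D s -> displaced_by D s^-1%g.
Proof.
move=> [h1 h2]; split.
  rewrite -(le_act hrho s) (actKV hrho) minimal_central_zexpg//.
  rewrite -(le_act hrho (zexpg f (- D%:Z))) -(actM hrho (zexpg f (- D%:Z))).
  by rewrite zexpgK (act1 hrho).
rewrite -(le_act hrho s) (actKV hrho) minimal_central_zexpg//.
rewrite -(le_act hrho (zexpg f D%:Z)) -(actM hrho (zexpg f D%:Z)).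
by rewrite -zexpgD subrr /= (act1 hrho).
Qed.

Lemma displaced_by_exists s : exists D, displaced_by D s.
Proof.
have [n hn] := cof Nf Xx0 f_gt (rho s x0).
have [m hm] := cof Nf Xx0 f_gt (rho s^-1%g x0).
exists (n + m)%N; split.
  by apply: ltW; apply: (lt_le_trans hn); rewrite -/(zexpg f n%:Z) lez// lez_nat leq_addr.
apply: le_trans (_ : rho (zexpg f (- m%:Z)) x0 <= _); first by apply: lez; lia.
rewrite -(le_act hrho (zexpg f m%:Z)) -(actM hrho (zexpg f m%:Z)).
rewrite -zexpgD subrr [zexpg f 0]/= (act1 hrho) -minimal_central_zexpg//.
by rewrite -(le_act hrho s^-1%g) (actK hrho) ltW.
Qed.

Lemma displaced_by_seq (S : seq G) : exists D, forall s, s \in S -> displaced_by D s.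
Proof.
elim: S => [|s S [D hD]]; first by exists 0%N.
have [D' hD'] := displaced_by_exists s.
exists (D + D')%N => t; rewrite inE => /predU1P[->|/hD].
  by apply: displaced_by_mono hD'; rewrite leq_addl.
by apply: displaced_by_mono; rewrite leq_addr.
Qed.

Lemma displaced_by_ball (S : seq G) D n w :
  (forall s, s \in S -> displaced_by D s) -> word_ball S n w ->
  displaced_by (D * n) w.
Proof.
move=> hD [l [sl hl ->]]; apply: (@displaced_by_mono (D * size l)).
  by rewrite leq_mul2l sl orbT.
elim: l {sl} hl => [_|s l IH] /=.
  by rewrite muln0; split; rewrite /= (act1 hrho).
move=> /andP[sS /IH hl]; rewrite mulnS; apply: displaced_byM => //.
case/orP: sS => [/hD//|/hD/displaced_byV]; by rewrite invgK.
Qed.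

(* Modulo [pstab rho X] the group [N] is infinite cyclic, central and
   undistorted, so the balls grow by at most a linear factor. *)
Lemma growth_central_extension (M : set G) :
  loc_subexp_quot R M N -> loc_subexp_quot R M (pstab rho X).
Proof.
move=> gM S SM c c1.
have [D hD] := displaced_by_seq S.
(* A fourth root of [c]: one factor [r ^+ 2] pays for the balls modulo [N], the other for the linear
   number of powers of [f]. *)
pose r : R := Num.sqrt (Num.sqrt c).
have sqrt1 (t : R) : 1 < t -> 1 < Num.sqrt t.
  by move=> t1; rewrite -[ltLHS]sqrtr1 ltr_sqrt// (lt_trans ltr01).
have r1 : 1 < r by exact: (sqrt1 _ (sqrt1 _ c1)).
have r2 : r ^+ 2 = Num.sqrt c by rewrite sqr_sqrtr// sqrtr_ge0.
have rc : r ^+ 2 * r ^+ 2 = c.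
  by rewrite r2 -expr2 sqr_sqrtr// ltW// (lt_trans ltr01).
have [n1 hn1] := linear_le_exp (2 * D + 1) r1.
have [|n2 hn2] := gM S SM (r ^+ 2); first by rewrite exprn_egt1.
exists (maxn n1 n2) => n; rewrite geq_max => /andP[/hn1 hA /hn2[m [hm [l [lm hl]]]]].
(* A representative [y] may lie outside the ball; [p y] records the position of [y x0] among the
   points [f ^ a x0], to correct for this. *)
have /choice[p hp] : forall y, exists a,
    rho (zexpg f a) x0 <= rho y x0 < rho (zexpg f (a + 1)) x0.
  by move=> y; exact: (zexpg_floor hrho nN sX sgn cof unb Xx0).
pose E := (2 * (D * n) + 1)%N.
(* On [X], an element of the ball is [y f ^ j] with [j + p y] between [- D n] and [D n]; the index
   [i] is [j + p y + D n], so there are [E] choices. *)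
pose el (y : G) (i : nat) : G := (y * zexpg f (i%:Z - (D * n)%:Z - p y))%g.
exists (m * E)%N; split.
  rewrite -rc exprMn natrM; apply: ler_pM => //.
  by apply: le_trans hA; rewrite ler_nat /E; lia.
exists [seq el y i | y <- l, i <- iota 0 E]; split.
  by rewrite size_allpairs size_iota leq_mul2r lm orbT.
move=> x Bx; have [y yl Nyx] := hl _ Bx.
have [j hj] := minimal_generates Nyx.
have xE z : X z -> rho x z = rho y (rho (zexpg f j) z).
  by move=> Xz; rewrite -hj// (actM hrho) (actKV hrho).
have [d1 d2] := displaced_by_ball hD Bx.
have /andP[p1 p2] := hp y.
have xj : rho x x0 = rho (zexpg f j) (rho y x0).
  by rewrite xE// minimal_central_zexpg.
have b1 : j + p y <= (D * n)%:Z.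
  by apply: zle; apply: le_trans d1; rewrite xj zexpgD (actM hrho) (le_act hrho).
have b2 : - (D * n)%:Z < j + p y + 1.
  rewrite ltNge; apply/negP => /lez; apply/negP; rewrite -ltNge.
  by apply: (le_lt_trans d2); rewrite xj -addrA zexpgD (actM hrho) (lt_act hrho).
have [i hi] : exists i : nat, i%:Z = j + p y + (D * n)%:Z.
  by exists (absz (j + p y + (D * n)%:Z)); lia.
have jE : j = i%:Z - (D * n)%:Z - p y by lia.
exists (el y i).
  by apply: allpairs_f => //; rewrite mem_iota /E; lia.
move=> z Xz; rewrite /el -jE (actM hrho) xE//.
by rewrite -(actM hrho y) (actK hrho).
Qed.

End DiscreteStep.

(** * Induction along the filtration *)

Section Descent.
Context (R : realType) (G : groupType) (rho : G -> R -> R).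
Hypothesis hrho : oph_action rho.
Context (T : G).
Hypothesis Tgt : forall x, x < rho T x.

(** Otherwise the lower bounds of an orbit would have a largest element, yet [T] maps the set of
    lower bounds into itself and moves points to the right. *)
Lemma stable_unbounded (X : set R) : X !=set0 -> action_stable rho X ->
  forall y, exists2 x, X x & x < y.
Proof.
move=> [x Xx] sX y; apply: contrapT => h.
have lb z : X z -> y <= z.
  by move=> Xz; rewrite leNgt; apply/negP => zy; apply: h; exists z.
pose B := [set z | forall k, z <= rho k x].
have yB : B y by move=> k; apply: lb; exact: sX.
have uB : has_ubound B by exists x => z /(_ 1%g); rewrite (act1 hrho).
have supB : B (sup B) by move=> k; apply: ge_sup; [exists y | move=> z; exact].
have : B (rho T (sup B)).
  move=> k; rewrite -(actKV hrho T (rho k x)) (le_act hrho) -(actM hrho).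
  exact: supB.
by move=> /(ub_le_sup uB); rewrite leNgt Tgt.
Qed.

(** The first conclusion ends the induction, when [N] is all of [G]. In the last alternative, the
    term before [N] inherits the hypotheses with [X] for [F]; the element [g] ensures that it fixes
    no point of [X]. *)
Lemma descent_step (N : set G) (F : set R) :
  normal_in_G N -> closed F -> action_stable rho F -> F !=set0 ->
  loc_subexp_quot R N (pstab rho F) ->
  (forall x, F x -> exists2 g, N g & rho g x <> x) ->
  (exists phi, affine_on rho N phi) /\
  ((exists phi, affine_on rho setT phi) \/
   exists X g, [/\ closed X, action_stable rho X, X !=set0,
     N g /\ (forall x, X x -> x < rho g x)
     & forall M, loc_subexp_quot R M N -> loc_subexp_quot R M (pstab rho X)]).
Proof.
move=> nN cF sF F0 gF nofix.
pose X := fixing_locus rho N F.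
have sX : action_stable rho X by exact: fixing_locus_stable.
have cX : closed X by exact: fixing_locus_closed.
have X0 : X !=set0 by exact: (fixing_locus_nonempty hrho gF nN cF sF F0 Tgt).
have [x0 Xx0] := X0.
have sgn := @fixing_locus_sign _ _ _ hrho _ _ nN cF sF.
have cof := @fixing_locus_cofinal _ _ _ hrho N F cF sF.
have unb := stable_unbounded X0 sX.
have [f Nf f_gt] : exists2 f, N f & x0 < rho f x0.
  have [g Ng /eqP] := nofix _ (proj1 Xx0).
  rewrite neq_lt => /orP[gx|xg]; last by exists g.
  exists g^-1%g; first by case: nN => -[_ _ NV] _; exact: NV.
  by rewrite -(lt_act hrho g) (actKV hrho).
split; first by eexists; exact: (hoelder_affine hrho nN sX sgn cof unb Xx0 Nf f_gt).
have [dense|] := pselect (forall g, N g -> x0 < rho g x0 ->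
    exists2 h, N h & x0 < rho h x0 < rho g x0).
  left; eexists.
  exact: (hoelder_affine_dense hrho nN sX sgn cof unb Xx0 Nf f_gt dense).
(* Failure of density gives a [g] such that [N] carries [x0] to no point strictly between [x0] and
   [g x0]. *)
move=> /existsNP[g] /not_implyP[Ng] /not_implyP[xg] hg; right.
have g_min h : N h -> x0 < rho h x0 -> rho g x0 <= rho h x0.
  move=> Nh xh; rewrite leNgt; apply/negP => gh.
  by apply: hg; exists h => //; rewrite xh gh.
exists X, g; split=> //.
  by split=> // x Xx; exact: (gt_act hrho nN sgn Xx0 Ng xg).
exact: (growth_central_extension hrho nN sX sgn cof unb Ng Xx0 xg g_min).
Qed.

(** The index decreases, so the groups grow up to [N 0], which is [G], while the closed stable set
    is replaced at each step. *)
Lemma affine_descent (N : nat -> set G) (d : nat) :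
  N 0%N = setT -> (forall i, (i <= d)%N -> normal_in_G (N i)) ->
  (forall i, (i < d)%N -> N i.+1 `<=` N i) ->
  (forall i, (i < d)%N -> loc_subexp_quot R (N i) (N i.+1)) ->
  forall F : set R, closed F -> action_stable rho F -> F !=set0 ->
    loc_subexp_quot R (N d) (pstab rho F) ->
    (forall x, F x -> exists2 g, N d g & rho g x <> x) ->
    exists phi, affine_on rho setT phi.
Proof.
move=> N0; elim: d => [|d IH] nN sub gN F cF sF F0 gF nofix.
  by rewrite -N0; exact: (proj1 (descent_step (nN 0%N _) cF sF F0 gF nofix)).
have [_ [//|[X [g [cX sX X0 [Ng gX] gr]]]]] :=
  descent_step (nN _ (leqnn _)) cF sF F0 gF nofix.
apply: (IH _ _ _ X) => //.
- by move=> i id; apply: nN; exact: leqW.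
- by move=> i id; apply: sub; exact: leqW.
- by move=> i id; apply: gN; exact: leqW.
- by apply: gr; exact: gN.
- move=> x Xx; exists g; first exact: (sub d (leqnn _)).
  by apply/eqP; rewrite gt_eqF// gX.
Qed.

Lemma exists_affine_map : in_class_S R G -> exists phi, affine_on rho setT phi.
Proof.
move=> [d [N [N0 Nd nN sub gN]]].
pose fixes i := `[< exists x, forall g, N i g -> rho g x = x >].
have fd : exists i, fixes i.
  by exists d.+1; apply/asboolP; exists 0 => g; rewrite Nd => ->; exact: act1.
have [i /asboolP[z hz] imin] := ex_minnP fd.
have id : (i <= d.+1)%N.
  by apply: imin; apply/asboolP; exists 0 => g; rewrite Nd => ->; exact: act1.
(* The index is not 0, since [T] belongs to [N 0]. *)
case: i hz imin id => [|i] hz imin id.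
  by have := Tgt z; rewrite hz ?ltxx// N0.
pose F := [set x | forall g, N i.+1 g -> rho g x = x].
have sF : action_stable rho F.
  move=> k x Fx g Ng; have := Fx _ (proj2 (nN _ id) k _ Ng).
  by rewrite !(actM hrho) => e; rewrite -[RHS](congr1 (rho k) e) (actKV hrho).
have cF : closed F.
  have -> : F = \bigcap_(g in N i.+1) [set x | rho g x = x] by [].
  by apply: closed_bigI => g _; exact: closed_fixed.
apply: (@affine_descent N i N0 _ _ _ F) => //.
- by move=> j ji; apply: nN; lia.
- by move=> j ji; apply: sub; lia.
- by move=> j ji; apply: gN; lia.
- by exists z.
(* The kernel of the action on [F] contains [N i.+1], so the same representatives cover the
   balls. *)
- move=> S SN c c1; have [n0 hn0] := gN i id S SN c c1.
  exists n0 => n /hn0[m [mc [l [lm hl]]]]; exists m; split=> //.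
  exists l; split=> // x /hl[y yl Nyx]; exists y => // w Fw; exact: Fw.
- move=> x Fx; apply: contrapT => h.
  have /imin : fixes i; last by rewrite ltnn.
  apply/asboolP; exists x => g Ng; apply: contrapT => gx.
  by apply: h; exists g.
Qed.

End Descent.

(** * Stieltjes measures *)

(** By the intermediate value theorem [rho T y - y] has constant sign, so [T] or its inverse
    works. *)
Lemma no_fixed_point_sign (R : realType) (G : groupType) (rho : G -> R -> R) T :
  oph_action rho -> (forall x, rho T x <> x) ->
  exists T', forall x, x < rho T' x.
Proof.
move=> hrho Tx.
have [|h] := pselect (forall x, x < rho T x); first by exists T.
have [z zT] : exists z, rho T z < z.
  apply: contrapT => hz; apply: h => x; rewrite lt_neqAle.
  rewrite eq_sym; apply/andP; split; first exact/eqP/Tx.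
  by rewrite leNgt; apply/negP => xT; apply: hz; exists x.
exists T^-1%g => x; rewrite -(lt_act hrho T) (actKV hrho) ltNge; apply/negP => xT.
pose q y : R := rho T y - y.
have cq : continuous q.
  have [_ cont _] := let: And3 _ _ h := hrho in h T.
  by move=> y; apply: (@cvgB _ R^o) => //; exact: cont.
have ivt a b : a <= b -> Num.min (q a) (q b) <= 0 <= Num.max (q a) (q b) -> False.
  move=> ab /(IVT ab) h0; have [|c _ /eqP] := h0.
    exact: continuous_subspaceT.
  by rewrite subr_eq0 => /eqP/Tx.
have qz : q z <= 0 by rewrite subr_le0 ltW.
have qx : 0 <= q x by rewrite subr_ge0.
have [xz|/ltW zx] := leP x z.
  by apply: (ivt _ _ xz); rewrite ge_min qz orbT le_max qx.
by apply: (ivt _ _ zx); rewrite ge_min qz le_max qx orbT.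
Qed.

(** * Right limits and Stieltjes measures of monotone functions *)

Section RightRegularization.
Context (R : realType).
Implicit Types phi : R -> R.

(** For monotone [phi] this is the right limit at [x], which provides the right continuity required
    of a cumulative function. *)
Definition right_reg phi (x : R) : R := inf [set phi y | y in [set y | x < y]].

Lemma right_reg_ge phi x r : (forall y, x < y -> r <= phi y) -> r <= right_reg phi x.
Proof.
move=> h; apply: lb_le_inf; last by move=> _ [y xy <-]; exact: h.
by exists (phi (x + 1)), (x + 1) => //=; rewrite ltrDl.
Qed.

Lemma right_reg_le phi x y : {homo phi : x y / x <= y} -> x < y ->
  right_reg phi x <= phi y.
Proof.
move=> hphi xy; apply: ge_inf; last by exists y.
by exists (phi x) => _ [z /= xz <-]; rewrite hphi// ltW.
Qed.

Lemma right_reg_homo phi : {homo phi : x y / x <= y} ->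
  {homo right_reg phi : x y / x <= y}.
Proof.
move=> hphi x y xy; apply: right_reg_ge => z yz.
by apply: right_reg_le => //; exact: le_lt_trans yz.
Qed.

Lemma right_reg_right_continuous phi : {homo phi : x y / x <= y} ->
  forall x, right_reg phi y @[y --> x^'+] --> right_reg phi x.
Proof.
move=> hphi x; apply/cvgrPdist_le => e e0.
have [_ [y /= xy <-] ye] : exists2 r, [set phi y | y in [set y | x < y]] r &
    r < right_reg phi x + e.
  apply: inf_lt; last by rewrite ltrDl.
  by exists (phi (x + 1)), (x + 1) => //=; rewrite ltrDl.
near=> z.
have xz : x < z by near: z; exact: nbhs_right_gt.
have zy : z < y by near: z; exact: nbhs_right_lt.
have xz' : right_reg phi x <= right_reg phi z.
  by apply: right_reg_homo => //; exact: ltW.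
rewrite distrC ger0_norm ?subr_ge0// lerBlDl (le_trans (right_reg_le hphi zy))// ltW//.
Unshelve. all: by end_near. Qed.

Definition right_reg_cumulative phi (hphi : {homo phi : x y / x <= y}) :
    cumulative R R :=
  HB.pack (right_reg phi) (isCumulative.Build R _ R (right_reg phi)
    (right_reg_homo hphi) (right_reg_right_continuous hphi)).

Definition stieltjes phi (hphi : {homo phi : x y / x <= y}) :
    {measure set (measurableTypeR R) -> \bar R} :=
  lebesgue_stieltjes_measure (right_reg_cumulative hphi).

Lemma stieltjes_itv phi (hphi : {homo phi : x y / x <= y}) (a b : R) : a <= b ->
  stieltjes hphi `]a, b]%classic = (right_reg phi b - right_reg phi a)%:E.
Proof.
move=> ab; rewrite /stieltjes /= /lebesgue_stieltjes_measure /measure_extension.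
rewrite measurable_mu_extE/=; last exact: is_ocitv.
by rewrite wlength_itv_bnd.
Qed.

Lemma stieltjes_unique phi (hphi : {homo phi : x y / x <= y})
    (mu : {measure set (measurableTypeR R) -> \bar R}) :
  (forall a b, a <= b ->
    mu `]a, b]%classic = (right_reg phi b - right_reg phi a)%:E) ->
  forall A, measurable A -> stieltjes hphi A = mu A.
Proof.
move=> h; apply: lebesgue_stieltjes_measure_unique => _ [[a b] _ <-] /=.
have [ab|ba] := leP a b; first by rewrite h// -(stieltjes_itv hphi).
by rewrite set_itv_ge ?measure0// bnd_simp -leNgt ltW.
Qed.

Lemma stieltjes_radon phi (hphi : {homo phi : x y / x <= y}) :
  radon (stieltjes hphi).
Proof.
move=> K cK; have [M [_ hM]] := compact_bounded cK.
(* The additional [- 1] keeps the point [- (M + 1)] inside the interval, which is open on the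
   left. *)
have {hM} KM : K `<=` `](- (M + 1) - 1), (M + 1)]%classic.
  move=> x Kx /=; have := hM (M + 1); rewrite ltrDl ltr01 => /(_ isT x Kx) /=.
  by rewrite ler_norml in_itv /= => /andP[h ->]; rewrite andbT (lt_le_trans _ h)// ltrBlDr ltrDl.
have [ab|ba] := leP (- (M + 1) - 1) (M + 1).
  apply: (@le_lt_trans _ _ (stieltjes hphi `](- (M + 1) - 1), (M + 1)]%classic)).
    apply: le_measure => //; rewrite inE; last exact: measurable_itv.
    exact: measurable_realfun.compact_measurable.
  by rewrite stieltjes_itv// ltry.
suff -> : K = set0 by rewrite measure0.
by apply/seteqP; split=> // x /KM /=; rewrite itv_ge// bnd_simp -leNgt ltW.
Qed.

End RightRegularization.

Lemma right_reg_affine (R : realType) (phi : R -> R) (lam c : R) :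
  {homo phi : x y / x <= y} -> 0 <= lam ->
  forall x, right_reg (fun x => lam * phi x + c) x = lam * right_reg phi x + c.
Proof.
move=> hphi lam0 x.
have h : {homo (fun x => lam * phi x + c) : x y / x <= y}.
  by move=> y z yz; rewrite lerD2r ler_wpM2l// hphi.
apply: le_anti; apply/andP; split; last first.
  by apply: right_reg_ge => y xy; rewrite lerD2r ler_wpM2l// right_reg_le.
(* The case [lam = 0] is separate because the other one divides by [lam]. *)
have /orP[/eqP l0|l0] : (0 == lam) || (0 < lam) by rewrite -le_eqVlt.
  have x1 : x < x + 1 by rewrite ltrDl.
  by rewrite (le_trans (right_reg_le h x1))// -l0 !mul0r.
rewrite -lerBlDr -ler_pdivrMl//; apply: right_reg_ge => y xy.
by rewrite ler_pdivrMl// lerBlDr; exact: (right_reg_le h).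
Qed.

Lemma right_reg_act (R : realType) (G : groupType) (rho : G -> R -> R) phi k :
  oph_action rho -> {homo phi : x y / x <= y} ->
  forall x, right_reg (phi \o rho k) x = right_reg phi (rho k x).
Proof.
move=> hrho hphi x.
have h : {homo phi \o rho k : x y / x <= y}.
  by move=> y z yz; apply: hphi; rewrite (le_act hrho).
apply: le_anti; apply/andP; split; apply: right_reg_ge => y xy.
  rewrite -[y](actKV hrho k); apply: (right_reg_le h).
  by rewrite -(lt_act hrho k) (actKV hrho).
by apply: right_reg_le => //; rewrite (lt_act hrho).
Qed.

Lemma preimage_act_itv (R : realType) (G : groupType) (rho : G -> R -> R) g a b :
  oph_action rho ->
  rho g @^-1` `]a, b]%classic = `]rho g^-1%g a, rho g^-1%g b]%classic.
Proof.
move=> hrho; apply/funext => x /=; rewrite !in_itv/=.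
by rewrite -[in RHS](lt_act hrho g) -[in RHS](le_act hrho g x) !(actKV hrho).
Qed.

(** The image of the measure under [g] is the Stieltjes measure of [phi \o rho g^-1], which is
    [lam * phi + c]; the constant cancels on intervals. *)
Lemma stieltjes_quasi_invariant (R : realType) (G : groupType)
    (rho : G -> R -> R) phi (hphi : {homo phi : x y / x <= y}) :
  oph_action rho -> affine_on rho setT phi -> quasi_invariant rho (stieltjes hphi).
Proof.
move=> hrho [_ _ aff] g; have [lam [c [lam0 hlam]]] := aff g^-1%g I.
exists lam => B mB; pose k := g^-1%g.
have hk : {homo phi \o rho k : x y / x <= y}.
  by move=> y z yz; apply: hphi; rewrite (le_act hrho).
have mg : measurable_fun setT (rho g : measurableTypeR R -> measurableTypeR R).
  apply: measurable_realfun.continuous_measurable_fun.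
  by case: hrho => _ _ /(_ g)[].
pose nu : {measure set (measurableTypeR R) -> \bar R} :=
  pushforward (stieltjes hphi) (rho g : measurableTypeR R -> measurableTypeR R).
pose mu' : {measure set (measurableTypeR R) -> \bar R} :=
  mscale (NngNum lam0) (stieltjes hphi).
transitivity (stieltjes hk B).
  symmetry; apply: (@stieltjes_unique _ _ hk (nu mg)) => // a b ab.
  rewrite /nu /= /pushforward /= preimage_act_itv// stieltjes_itv ?(le_act hrho)//.
  by rewrite !(right_reg_act k hrho).
apply: (@stieltjes_unique _ _ hk mu') => // a b ab.
rewrite /mu' /= /mscale /= stieltjes_itv// -EFinM; congr EFin.
have -> : phi \o rho k = (fun x => lam * phi x + c) by apply/funext => x; exact: hlam.
by rewrite !right_reg_affine//; ring.
Qed.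

Unset Implicit Arguments.

Theorem theoremA (R : realType) (G : groupType) (rho : G -> R -> R) :
  in_class_S R G ->
  oph_action rho ->
  (exists T : G, forall x : R, rho T x <> x) ->
  exists mu : {measure set (measurableTypeR R) -> \bar R},
    [/\ radon mu,
        exists2 A : set (measurableTypeR R), measurable A & mu A <> 0%E
      & quasi_invariant rho mu].
Proof.
move=> GS hrho [T0 hT0].
have [T Tgt] := no_fixed_point_sign hrho hT0.
have [phi aff] := exists_affine_map hrho Tgt GS.
have [hphi [a [b ab]] _] := aff.
exists (stieltjes hphi); split; first exact: stieltjes_radon.
  (* As [phi] may jump just after [a], the interval starts further left: the right limit at [a - 1]
     is at most [phi a < phi b]. *)
  exists `](a - 1), b]%classic; first exact: measurable_itv.
  have ab' : a <= b by rewrite leNgt; apply/negP => /ltW/hphi; rewrite leNgt ab.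
  have a1 : a - 1 < a by rewrite ltrBlDr ltrDl.
  rewrite (stieltjes_itv hphi (le_trans (ltW a1) ab')).
  apply/eqP; rewrite eqe subr_eq0 gt_eqF//.
  apply: le_lt_trans (right_reg_le hphi a1) (lt_le_trans ab _).
  by apply: right_reg_ge => y by'; rewrite hphi// ltW.
exact: stieltjes_quasi_invariant.
Qed.
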